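(* Let $M=2$, let $N$ be a positive integer, and for $\Phi=\{\varphi_n\}_{n=1}^N\subseteq\mathbb{C}^M$ let $\mathcal{A}\colon\mathbb{C}^M/\mathbb{T}\rightarrow\mathbb{R}^N$ be defined by $(\mathcal{A}(x))(n):=|\langle x,\varphi_n\rangle|^2$. Then: (a) If $N<4M-4=4$, then $\mathcal{A}$ is not injective (for any $\Phi$). (b) If $N\geq 4M-4=4$, then $\mathcal{A}$ is injective for generic $\Phi$.
   Context: $\mathbb{T}=\{c\in\mathbb{C}:|c|=1\}$. $\mathbb{C}^M/\mathbb{T}$ denotes $\mathbb{C}^M$ with $x$ and $y$ identified whenever $y=cx$ for some $c\in\mathbb{T}$; injectivity of $\mathcal{A}$ means: $\mathcal{A}(x)=\mathcal{A}(y)$ implies $y=cx$ for some $c\in\mathbb{T}$. The inner product on $\mathbb{C}^M$ is $\langle x,\varphi\rangle=\varphi^*x$. A real algebraic variety in $\mathbb{R}^n$ is the set of common zeros of a finite set of polynomials with real coefficients; the Zariski topology on $\mathbb{R}^n$ has exactly these sets as closed sets. View $\Phi$ as an element of $\mathbb{R}^{2MN}$ via the real and imaginary parts of the entries of the $\varphi_n$. A property holds for generic $\Phi$ if there is a nonempty Zariski-open subset of $\mathbb{R}^{2MN}$ such that the property holds for every $\Phi$ in it. *)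

(* Defs.v *)
From mathcomp Require Import all_boot all_order all_algebra.
From mathcomp Require Import sesquilinear spectral.
From mathcomp Require Import classical_sets reals.
From mathcomp Require Import complex mpoly.

Set Implicit Arguments.
Unset Strict Implicit.
Unset Printing Implicit Defensive.

Import Order.TTheory GRing.Theory Num.Theory.

Local Open Scope ring_scope.
Local Open Scope sesquilinear_scope.
Local Open Scope classical_set_scope.

Section IntensityMeasurements.
Variables (R : realType) (M N : nat).
Implicit Types (x y phi : 'cV[R[i]]_M) (Phi : 'M[R[i]]_(M, N)).

Definition inner x phi : R[i] := (phi^t* *m x) 0 0.

(* The family {phi_n} is the family of columns of Phi. *)
Definition intensity Phi x : 'rV[R]_N :=
  \row_n Normc.normc (inner x (col n Phi)) ^+ 2.

Definition phase_equiv x y : Prop :=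
  exists c : R[i], `|c| = 1 /\ y = c *: x.

(* Injectivity of the map induced by [intensity Phi] on C^M / T; that the map
   descends to this quotient is [intensity_phase] below. *)
Definition injective_mod_phase Phi : Prop :=
  forall x y, intensity Phi x = intensity Phi y -> phase_equiv x y.

Lemma intensity_phase Phi x y :
  phase_equiv x y -> intensity Phi x = intensity Phi y.
Proof.
move=> [c [c1 ->]]; apply/rowP => n; rewrite !mxE /inner -scalemxAr.
by rewrite [in RHS]mxE Normc.normcM; case: c1 => ->; rewrite mul1r.
Qed.

Lemma phase_equiv_refl x : phase_equiv x x.
Proof. by exists 1; rewrite normr1 scale1r. Qed.

Lemma phase_equiv_sym x y : phase_equiv x y -> phase_equiv y x.
Proof.
move=> [c [c1 ->]]; exists c^-1; rewrite normfV c1 invr1 scalerA mulVf ?scale1r//.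
by rewrite -normr_eq0 c1 oner_eq0.
Qed.

Lemma phase_equiv_trans x y z :
  phase_equiv x y -> phase_equiv y z -> phase_equiv x z.
Proof.
move=> [c [c1 ->]] [d [d1 ->]]; exists (d * c).
by rewrite normrM c1 d1 mulr1 scalerA.
Qed.

End IntensityMeasurements.

Section ZariskiTopology.
Variables (R : realType) (n : nat).

Definition real_algebraic_variety (V : set 'rV[R]_n) : Prop :=
  exists ps : seq {mpoly R[n]},
    V = [set v | forall p, p \in ps -> p.@[fun i => v 0 i] = 0].

Definition zariski_open (U : set 'rV[R]_n) : Prop :=
  real_algebraic_variety (~` U).

End ZariskiTopology.

(* The point of R^(2MN) whose coordinates are the real parts of the entries of
   Phi followed by their imaginary parts. *)
Definition real_coords (R : realType) (M N : nat) (Phi : 'M[R[i]]_(M, N)) :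
    'rV[R]_(M * N + M * N) :=
  row_mx (mxvec (map_mx (@complex.Re R) Phi))
         (mxvec (map_mx (@complex.Im R) Phi)).

Definition generically (R : realType) (M N : nat)
    (P : 'M[R[i]]_(M, N) -> Prop) : Prop :=
  exists U : set 'rV[R]_(M * N + M * N),
    [/\ zariski_open U, U !=set0 &
        forall Phi, U (real_coords Phi) -> P Phi].

Lemma real_coords_bij (R : realType) (M N : nat) :
  bijective (@real_coords R M N).
Proof.
exists (fun v => \matrix_(i, j)
  Complex (vec_mx (lsubmx v) i j) (vec_mx (rsubmx v) i j)) => [Phi | v].
  apply/matrixP => i j; rewrite mxE /real_coords row_mxKl row_mxKr !mxvecK.
  by rewrite !mxE; case: (Phi i j).
rewrite -[RHS]hsubmxK /real_coords; congr row_mx.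
  by rewrite -[RHS]vec_mxK; congr mxvec; apply/matrixP => i j; rewrite !mxE.
by rewrite -[RHS]vec_mxK; congr mxvec; apply/matrixP => i j; rewrite !mxE.
Qed.

(* Main.v *)
(* The intensities are linear in the rank one Hermitian matrix xx*, which lives
   in a real space of dimension 4 and determines x up to phase. With at most 3
   vectors some Hermitian H <> 0 has all its measurements zero. If det H <= 0,
   then 2H = xx* - yy*, so x and y have equal intensities without being
   equivalent; if det H > 0, then H is definite and phi* H phi = 0 forces
   Phi = 0. With at least 4 vectors, the determinant of the functionals of the
   first 4 is a nonzero polynomial in Phi, and injectivity holds wherever it does
   not vanish. *)
Require Import Defs.
From mathcomp Require Import all_boot all_order all_algebra.
From mathcomp Require Import reals complex.
From mathcomp Require Import classical_sets mpoly ring lra.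

Set Implicit Arguments.
Unset Strict Implicit.
Unset Printing Implicit Defensive.

Import Order.TTheory GRing.Theory Num.Theory.
Local Open Scope ring_scope.

(* P and Q are the real and imaginary parts of a family phi_j. Column j is the
   functional H |-> phi_j* H phi_j, in the coordinates H_00, H_11, Re H_01 and
   Im H_01, which are also those of [herm_coords]. *)
Definition frame_mx (A : comNzRingType) (n : nat) (P Q : 'M[A]_(2, n)) :
    'M[A]_(4, n) :=
  \matrix_(k, j) [:: P 0 j ^+ 2 + Q 0 j ^+ 2;
                     P 1 j ^+ 2 + Q 1 j ^+ 2;
                     2 * (P 0 j * P 1 j + Q 0 j * Q 1 j);
                     2 * (Q 0 j * P 1 j - P 0 j * Q 1 j)]`_k.

(** Applied to evaluation of polynomials, this specializes the matrix of indeterminates to that of a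
    given family. *)
Lemma map_frame_mx (A B : comNzRingType) (f : {rmorphism A -> B}) (n : nat)
    (P Q : 'M[A]_(2, n)) :
  map_mx f (frame_mx P Q) = frame_mx (map_mx f P) (map_mx f Q).
Proof.
apply/matrixP => -[[|[|[|[|//]]]] ltk] j; rewrite !mxE /=.
- by rewrite rmorphD !rmorphXn.
- by rewrite rmorphD !rmorphXn.
- by rewrite rmorphM rmorph_nat rmorphD !rmorphM.
- by rewrite rmorphM rmorph_nat rmorphB !rmorphM.
Qed.

(** * Hermitian coordinates of a vector and recovery of its phase *)

Section Lift.
Variable R : realType.
Local Notation C := R[i].
Local Notation Re := (@complex.Re R).
Local Notation Im := (@complex.Im R).

(** These are the coordinates of H = xx*; the factor 2 of the off-diagonal terms sits in
    [frame_mx]. *)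
Definition herm_coords (x : 'cV[C]_2) : 'rV[R]_4 :=
  let a := x 0 0 in let b := x 1 0 in
  \row_k [:: Re a ^+ 2 + Im a ^+ 2;
             Re b ^+ 2 + Im b ^+ 2;
             Re a * Re b + Im a * Im b;
             Im a * Re b - Re a * Im b]`_k.

Definition pair_cV (a b : C) : 'cV[C]_2 := \col_k (if k == 0 then a else b).

Definition frame_of (n : nat) (Phi : 'M[C]_(2, n)) : 'M[R]_(4, n) :=
  frame_mx (map_mx Re Phi) (map_mx Im Phi).

Lemma intensityE (n : nat) (Phi : 'M[C]_(2, n)) (x : 'cV[C]_2) :
  intensity Phi x = herm_coords x *m frame_of Phi.
Proof.
apply/rowP => j; rewrite !mxE /inner mxE !big_ord_recl !big_ord0 /= !mxE /=.
have -> : lift ord0 ord0 = 1 :> 'I_2 by apply/val_inj.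
have -> : (ord0 : 'I_2) = 0 by apply/val_inj.
case: (Phi 0 j) (Phi 1 j) (x 0 0) (x 1 0) => [p p'] [q q'] [a a'] [b b'] /=.
rewrite sqr_sqrtr ?addr_ge0 ?sqr_ge0 //; ring.
Qed.

Lemma normc_sqr (z : C) : `|z| ^+ 2 = (Re z ^+ 2 + Im z ^+ 2)%:C%C.
Proof.
by case: z => a b; rewrite normc_def /= -rmorphXn sqr_sqrtr ?addr_ge0 ?sqr_ge0.
Qed.

Lemma herm_coordsP (x y : 'cV[C]_2) :
  herm_coords x = herm_coords y ->
  [/\ `|x 0 0| = `|y 0 0|, `|x 1 0| = `|y 1 0| &
      x 0 0 * (x 1 0)^* = y 0 0 * (y 1 0)^*].
Proof.
move=> /rowP xy; split.
- apply/eqP; rewrite -(@eqrXn2 _ 2) ?normr_ge0 // !normc_sqr.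
  by have := xy 0; rewrite !mxE /= => ->.
- apply/eqP; rewrite -(@eqrXn2 _ 2) ?normr_ge0 // !normc_sqr.
  by have := xy 1; rewrite !mxE /= => ->.
- have := xy 2; have := xy 3; rewrite !mxE /=.
  case: (x 0 0) (x 1 0) (y 0 0) (y 1 0) => [p p'] [q q'] [a a'] [b b'] /= e3 e2.
  by apply/eqP; rewrite eq_complex /=; apply/andP; split; apply/eqP; lra.
Qed.

(** The phase is the ratio of y to x in a nonzero coordinate. Equal moduli make it unimodular, and
    the off-diagonal entry carries it over to the other coordinate. *)
Lemma herm_coords_inj (x y : 'cV[C]_2) :
  herm_coords x = herm_coords y -> phase_equiv x y.
Proof.
move=> /herm_coordsP [n0 n1 e].
have ext (c : C) : y 0 0 = c * x 0 0 -> y 1 0 = c * x 1 0 -> y = c *: x.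
  move=> c0 c1; apply/colP => -[[|[|//]] ltk]; rewrite mxE.
    by rewrite (_ : Ordinal _ = 0) //; apply/val_inj.
  by rewrite (_ : Ordinal _ = 1) //; apply/val_inj.
have [x0 | x0] := eqVneq (x 0 0) 0.
  have y0 : y 0 0 = 0 by apply/eqP; rewrite -normr_eq0 -n0 x0 normr0.
  have [x1 | x1] := eqVneq (x 1 0) 0.
    have y1 : y 1 0 = 0 by apply/eqP; rewrite -normr_eq0 -n1 x1 normr0.
    exists 1; split; first by rewrite normr1.
    by apply: ext; rewrite ?x0 ?x1 ?y0 ?y1 mulr0.
  exists (y 1 0 / x 1 0); split.
    by rewrite normrM normfV n1 divff // -n1 normr_eq0.
  by apply: ext; rewrite ?x0 ?y0 ?mulr0 // divfK.
have y0 : y 0 0 != 0 by rewrite -normr_eq0 -n0 normr_eq0.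
exists (y 0 0 / x 0 0); split.
  by rewrite normrM normfV n0 divff // -n0 normr_eq0.
apply: ext; first by rewrite divfK.
have y0' : (y 0 0)^* != 0 by rewrite fmorph_eq0.
apply: (mulfI y0'); have := congr1 Num.conj e.
rewrite !rmorphM /= !conjCK => <-.
have nn : x 0 0 * (x 0 0)^* = y 0 0 * (y 0 0)^* by rewrite -!normCK n0.
apply: (mulfI x0).
have -> : x 0 0 * ((y 0 0)^* * (y 0 0 / x 0 0 * x 1 0)) =
  y 0 0 * (y 0 0)^* * x 1 0 by field.
by rewrite -nn mulrA.
Qed.

Lemma phase_equiv_herm_coords (x y : 'cV[C]_2) :
  phase_equiv x y -> herm_coords x = herm_coords y.
Proof.
move=> [c [c1 ->]].
have : Re c ^+ 2 + Im c ^+ 2 = 1.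
  by have := normc_sqr c; rewrite c1 expr1n => -[<-].
case: c {c1} => c d /= cd; apply/rowP => k; rewrite !mxE.
case: (x 0 0) (x 1 0) => [a a'] [b b'] /=.
case: k => -[|[|[|[|//]]]] ltk /=.
- transitivity ((c ^+ 2 + d ^+ 2) * (a ^+ 2 + a' ^+ 2)); last by ring.
  by rewrite cd mul1r.
- transitivity ((c ^+ 2 + d ^+ 2) * (b ^+ 2 + b' ^+ 2)); last by ring.
  by rewrite cd mul1r.
- transitivity ((c ^+ 2 + d ^+ 2) * (a * b + a' * b')); last by ring.
  by rewrite cd mul1r.
- transitivity ((c ^+ 2 + d ^+ 2) * (a' * b - a * b')); last by ring.
  by rewrite cd mul1r.
Qed.

(** * Fewer than four vectors *)

(* With x = p + q and y = p - q one has xx* - yy* = 2(pq* + qp* ), so it is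
   enough to solve pq* + qp* = H. *)
Lemma herm_coords_subr (h : 'rV[R]_4) :
  h 0 0 * h 0 1 <= h 0 2 ^+ 2 + h 0 3 ^+ 2 ->
  exists x y, herm_coords x - herm_coords y = 2 *: h.
Proof.
set s := h 0 0; set t := h 0 1; set u := h 0 2; set v := h 0 3 => det_le0.
suff [p [p' [q [q' [r [r' [m [m' [es et eu ev]]]]]]]]] :
    exists p p' q q' r r' m m' : R,
    [/\ 2 * (p * r + p' * r') = s, 2 * (q * m + q' * m') = t,
        p * m + p' * m' + (r * q + r' * q') = u &
        p' * m - p * m' + (r' * q - r * q') = v].
  exists (pair_cV (p +i* p')%C (q +i* q')%C + pair_cV (r +i* r')%C (m +i* m')%C).
  exists (pair_cV (p +i* p')%C (q +i* q')%C - pair_cV (r +i* r')%C (m +i* m')%C).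
  apply/rowP => k; rewrite !mxE /=; case: k => -[|[|[|[|//]]]] ltk /=.
  - by rewrite (_ : Ordinal ltk = 0) -/s -?es; [ring | apply/val_inj].
  - by rewrite (_ : Ordinal ltk = 1) -/t -?et; [ring | apply/val_inj].
  - by rewrite (_ : Ordinal ltk = 2) -/u -?eu; [ring | apply/val_inj].
  - by rewrite (_ : Ordinal ltk = 3) -/v -?ev; [ring | apply/val_inj].
have [s0 | s0] := eqVneq s 0; last first.
  (* The second vector is (1, m + im') and the first one starts with s / 2. Then H_01 fixes q and
     q', and H_11 = t is a quadratic equation, solved by m' = - v / s and a root m involving d,
     where d^2 = - det H. *)
  pose d := Num.sqrt (u ^+ 2 + v ^+ 2 - s * t).
  have d2 : d ^+ 2 = u ^+ 2 + v ^+ 2 - s * t by rewrite sqr_sqrtr // subr_ge0.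
  pose m := (u + d) / s; pose m' := - v / s.
  exists (s / 2), 0, (u - s / 2 * m), (- v - s / 2 * m'), 1, 0, m, m'.
  split; [by field | | by ring | by ring].
  transitivity ((u ^+ 2 + v ^+ 2 - d ^+ 2) / s); first by rewrite /m /m'; field.
  by rewrite d2; field.
have [w0 | w0] := eqVneq (u ^+ 2 + v ^+ 2) 0.
  have [u0 v0] : u = 0 /\ v = 0.
    by move/eqP: w0; rewrite paddr_eq0 ?sqr_ge0 // !sqrf_eq0
      => /andP[/eqP-> /eqP->].
  exists 0, 0, (t / 2), 0, 0, 0, 1, 0.
  by rewrite s0 u0 v0; split; [ring | field | ring | ring].
(* Since H_00 = 0, the vectors (0, u - iv) and (1, k(u - iv)) give H_01 for every k, and k adjusts
   H_11. *)
pose k := t / 2 / (u ^+ 2 + v ^+ 2).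
exists 0, 0, u, (- v), 1, 0, (k * u), (- k * v).
by rewrite s0; split; [ring | rewrite /k; field | ring | ring].
Qed.

(** For each column, s phi* H phi = |s phi_0 + H_01 phi_1|^2 + det H |phi_1|^2, where both terms are
    nonnegative and s is nonzero. *)
Lemma definite_frame_eq0 (n : nat) (Phi : 'M[C]_(2, n)) (h : 'rV[R]_4) :
  h 0 2 ^+ 2 + h 0 3 ^+ 2 < h 0 0 * h 0 1 -> h *m frame_of Phi = 0 -> Phi = 0.
Proof.
set s := h 0 0; set t := h 0 1; set u := h 0 2; set v := h 0 3 => det_gt0.
move=> /rowP h0; suff colE j : Phi 0 j = 0 /\ Phi 1 j = 0.
  apply/matrixP => -[[|[|//]] ltk] j; rewrite mxE; have [e0 e1] := colE j.
    by rewrite -[RHS]e0; congr (Phi _ _); apply/val_inj.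
  by rewrite -[RHS]e1; congr (Phi _ _); apply/val_inj.
have := h0 j; rewrite !mxE !big_ord_recl big_ord0 /= !mxE /=.
have -> : h 0 ord0 = s by congr (h _ _); apply/val_inj.
have -> : h 0 (lift ord0 ord0) = t by congr (h _ _); apply/val_inj.
have -> : h 0 (lift ord0 (lift ord0 ord0)) = u by congr (h _ _); apply/val_inj.
have -> : h 0 (lift ord0 (lift ord0 (lift ord0 ord0))) = v.
  by congr (h _ _); apply/val_inj.
case: (Phi 0 j) (Phi 1 j) => [p p'] [q q'] /= e.
have w_ge0 : 0 <= u ^+ 2 + v ^+ 2 by rewrite addr_ge0 ?sqr_ge0.
have s_neq0 : s != 0 by apply/eqP => s0; move: det_gt0; rewrite s0 mul0r; lra.
have d_gt0 : 0 < s * t - (u ^+ 2 + v ^+ 2) by rewrite subr_gt0.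
(* completing the square in s * (phi* H phi) = 0 *)
have sq : (s * p + u * q - v * q') ^+ 2 + (s * p' + u * q' + v * q) ^+ 2 +
    (s * t - (u ^+ 2 + v ^+ 2)) * (q ^+ 2 + q' ^+ 2) = 0.
  by rewrite -[RHS](mulr0 s) -e; ring.
have qq : q ^+ 2 + q' ^+ 2 = 0.
  have qq_ge0 : 0 <= q ^+ 2 + q' ^+ 2 by rewrite addr_ge0 ?sqr_ge0.
  move/eqP: sq; rewrite paddr_eq0 ?addr_ge0 ?sqr_ge0 //; last first.
    by rewrite mulr_ge0 // ltW.
  by rewrite mulf_eq0 (gt_eqF d_gt0) => /andP[_ /eqP].
have [q0 q0'] : q = 0 /\ q' = 0.
  by move/eqP: qq; rewrite paddr_eq0 ?sqr_ge0 // !sqrf_eq0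
    => /andP[/eqP-> /eqP->].
have /eqP : (s * p) ^+ 2 + (s * p') ^+ 2 = 0 by rewrite -sq q0 q0'; ring.
rewrite paddr_eq0 ?sqr_ge0 // !sqrf_eq0 !mulf_eq0 (negPf s_neq0) /=.
by move=> /andP[/eqP-> /eqP->]; rewrite q0 q0'.
Qed.

Lemma not_injective_lt4 (n : nat) (Phi : 'M[C]_(2, n)) :
  (n < 4)%N -> ~ injective_mod_phase Phi.
Proof.
move=> n4 inj.
have [h h_neq0 hF] : exists2 h : 'rV[R]_4, h != 0 & h *m frame_of Phi = 0.
  have K0 : kermx (frame_of Phi) != 0.
    rewrite -mxrank_eq0 mxrank_ker -lt0n subn_gt0.
    exact: leq_ltn_trans (rank_leq_col _) n4.
  exists (nz_row (kermx (frame_of Phi))); first by rewrite nz_row_eq0.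
  by apply/sub_kermxP; apply: nz_row_sub.
have [det_le0 | det_gt0] :=
    leP (h 0 0 * h 0 1) (h 0 2 ^+ 2 + h 0 3 ^+ 2).
  have [x [y xy]] := herm_coords_subr det_le0.
  have /inj/phase_equiv_herm_coords : intensity Phi x = intensity Phi y.
    apply/eqP; rewrite !intensityE -subr_eq0 -mulmxBl xy -scalemxAl hF.
    by rewrite scaler0.
  move=> e; move: xy; rewrite e subrr => /esym/eqP.
  by rewrite scaler_eq0 pnatr_eq0 (negPf h_neq0).
(* The zero family does not separate 0 from the all-ones vector. *)
have Phi0 := definite_frame_eq0 det_gt0 hF.
have /inj[c [_ /colP/(_ 0)]] :
    intensity Phi 0 = intensity Phi (const_mx 1).
  have F0 : frame_of Phi = 0.
    apply/matrixP => -[[|[|[|[|//]]]] ltk] j;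
      by rewrite Phi0 !mxE /= ?expr0n ?mulr0 ?subr0 ?addr0 ?mulr0.
  by rewrite !intensityE F0 !mulmx0.
by rewrite !mxE mulr0 => /eqP; rewrite oner_eq0.
Qed.

(** * Four or more vectors *)

Lemma injective_of_det (n : nat) (f : 'I_4 -> 'I_n) (Phi : 'M[C]_(2, n)) :
  \det (colsub f (frame_of Phi)) != 0 -> injective_mod_phase Phi.
Proof.
move=> detF x y; rewrite !intensityE => e; apply: herm_coords_inj.
(* Four measurements already determine xx*, by cancelling an invertible block. *)
have uF : colsub f (frame_of Phi) \in unitmx by rewrite unitmxE unitfE.
apply: (can_inj (mulmxK uF)); rewrite !mulmx_colsub.
by rewrite e.
Qed.

(** The vectors e_0, e_1, e_0 + e_1, e_0 + i e_1, then copies of e_0 through the default 0 of the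
    list: a witness that the determinant polynomial is nonzero. *)
Definition standard_frame (n : nat) : 'M[C]_(2, n) :=
  \matrix_(k, j) if k == 0 then (if val j == 1%N then 0 else 1)
                 else [:: 0; 1; 1; 'i%C]`_j.

Lemma det_standard_frame (n : nat) (f : 'I_4 -> 'I_n) :
  (forall k, val (f k) = k) ->
  \det (colsub f (frame_of (standard_frame n))) = - 4.
Proof.
move=> fE; rewrite -det_tr det_trig.
  rewrite !big_ord_recl big_ord0 /= !mxE /= !fE /=.
  by ring.
apply/is_trig_mxP => -[[|[|[|[|//]]]] lti] [[|[|[|[|//]]]] ltj] //= _;
  rewrite !mxE /= !fE /=; ring.
Qed.

Lemma generically_injective (n : nat) :
  (4 <= n)%N -> generically (fun Phi : 'M[C]_(2, n) => injective_mod_phase Phi).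
Proof.
move=> n4; pose f := widen_ord n4.
(* The indeterminates are indexed as in [real_coords], real parts before imaginary parts. *)
pose P : 'M[{mpoly R[2 * n + 2 * n]}]_(2, n) :=
  \matrix_(k, j) 'X_(lshift (2 * n) (mxvec_index k j)).
pose Q : 'M[{mpoly R[2 * n + 2 * n]}]_(2, n) :=
  \matrix_(k, j) 'X_(rshift (2 * n) (mxvec_index k j)).
pose D := \det (colsub f (frame_mx P Q)).
have DE Phi : D.@[fun i => real_coords Phi 0 i] =
    \det (colsub f (frame_of Phi)).
  rewrite /D -det_map_mx; congr (\det _).
  rewrite map_mxsub map_frame_mx; congr (colsub f (frame_mx _ _));
    apply/matrixP => k j; rewrite !mxE /= mevalXU.
    by rewrite row_mxEl mxvecE mxE.
  by rewrite row_mxEr mxvecE mxE.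
exists [set v | D.@[fun i => v 0 i] != 0]%classic; split.
- exists [:: D]; apply/seteqP; split => v /=.
    move=> /negP; rewrite negbK => /eqP Dv p; rewrite inE => /eqP -> //.
  by move=> /(_ D); rewrite inE eqxx => /(_ isT) ->; rewrite eqxx.
- exists (real_coords (standard_frame n)) => /=.
  by rewrite DE det_standard_frame // oppr_eq0 pnatr_eq0.
- by move=> Phi /=; rewrite DE; apply: injective_of_det.
Qed.

End Lift.

Local Close Scope ring_scope.

Theorem theorem10 (R : realType) (M N : nat) (hM : M = 2) (hN : 0 < N) :
  (N < 4 * M - 4 ->
     forall Phi : 'M[R[i]]_(M, N), ~ injective_mod_phase Phi) /\
  (4 * M - 4 <= N ->
     generically (fun Phi : 'M[R[i]]_(M, N) => injective_mod_phase Phi)).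
Proof.
subst M; split=> [N4 Phi|N4].
- exact: not_injective_lt4.
- exact: generically_injective.
Qed.
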